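(* Let $A=(a_{ij})$ be a $2\times4$ matrix of real functions of $(x,y)$ on an open set of $\mathbb R^2$. Suppose that there are $\gamma,\delta\in\mathbb R$ and functions $b_{13},b_{14},b_{23},b_{24}$ of $(x,y)$ such that $F_1=(-b_{14},b_{13})$ and $F_2=(-b_{24},b_{23})$ are conservative vector fields with potential functions $\varphi_1$ and $\varphi_2$, respectively (that is, $\nabla\varphi_i=F_i$), and such that the system $\langle A:dw\rangle=0$ is equivalent to the system $$\begin{aligned} (\gamma b_{13}+b_{23})u_x+(\gamma b_{14}+b_{24})u_y+b_{13}v_x+b_{14}v_y&=0,\\ \delta b_{13}u_x+\delta b_{14}u_y+b_{23}v_x+b_{24}v_y&=0.\end{aligned}$$ Then the $\varphi\mathbb A$-differentiable functions $w=(u,v)$ are solutions of $\langle A:dw\rangle=0$, where $\varphi=(\varphi_1,\varphi_2)$ and $\mathbb A=\mathbb A^2_2(\gamma,\delta)$.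
   Context: For $w=(u,v)$, $\langle A:dw\rangle=0$ denotes the system $a_{i1}u_x+a_{i2}u_y+a_{i3}v_x+a_{i4}v_y=0$, $i=1,2$. Two homogeneous systems with coefficient matrices $A_1,A_2$ are equivalent if there is a $2\times2$ matrix valued function $M=M(x,y)$, nonsingular at every point, with $A_2=MA_1$. $\mathbb A^2_2(\gamma,\delta)$ is $\mathbb R^2$ with the commutative bilinear product $e_1e_1=\gamma e_1+\delta e_2$, $e_1e_2=e_1$, $e_2e_2=e_2$. A function $f:U\subset\mathbb R^2\to\mathbb R^2$, differentiable in the usual sense, is $\varphi\mathbb A$-differentiable if there is a function $f'_\varphi:U\to\mathbb R^2$ such that $df_p(\xi)=f'_\varphi(p)\,d\varphi_p(\xi)$ ($\mathbb A$-product) for all $p\in U$, $\xi\in\mathbb R^2$. *)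

(* Defs.v *)
From HB Require Import structures.
From mathcomp Require Import all_boot all_order all_algebra.
From mathcomp Require Import all_classical all_reals all_analysis.

Set Implicit Arguments.
Unset Strict Implicit.
Unset Printing Implicit Defensive.

Import Order.TTheory GRing.Theory Num.Theory.
Import numFieldNormedType.Exports.

Local Open Scope classical_set_scope.
Local Open Scope ring_scope.

Definition vec2 (R : realType) (a b : R) : 'rV[R]_2 := \row_j [:: a; b]`_j.

(* [e1 R] and [e2 R] are both the x- and y-directions of the plane and the
   basis of the algebra [A22] below. *)
Definition e1 (R : realType) : 'rV[R]_2 := vec2 1 0.
Definition e2 (R : realType) : 'rV[R]_2 := vec2 0 1.

(* The table e1 e1 = gamma e1 + delta e2, e1 e2 = e2 e1 = e1, e2 e2 = e2,
   with e1, e2 indexed by 0, 1. *)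
Definition A22_table (R : realType) (gamma delta : R) (i j : 'I_2) : 'rV[R]_2 :=
  if (i == 0) && (j == 0) then gamma *: e1 R + delta *: e2 R
  else if (i == 1) && (j == 1) then e2 R
  else e1 R.

Definition A22_mul (R : realType) (gamma delta : R) (a b : 'rV[R]_2) : 'rV[R]_2 :=
  \sum_(i < 2) \sum_(j < 2) (a 0 i * b 0 j) *: A22_table gamma delta i j.

(* phi is assumed differentiable on U wherever this is used ('d phi p is
   unspecified otherwise). *)
Definition phiA_differentiable (R : realType) (gamma delta : R)
    (U : set 'rV[R]_2) (phi f : 'rV[R]_2 -> 'rV[R]_2) : Prop :=
  (forall p, U p -> differentiable f p) /\
  exists f' : 'rV[R]_2 -> 'rV[R]_2, forall p xi, U p ->
    'd f p xi = A22_mul gamma delta (f' p) ('d phi p xi).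

Definition gradient (R : realType) (g : 'rV[R]_2 -> R) (p : 'rV[R]_2) : 'rV[R]_2 :=
  vec2 ('D_(e1 R) g p) ('D_(e2 R) g p).

Definition potential (R : realType) (U : set 'rV[R]_2)
    (F : 'rV[R]_2 -> 'rV[R]_2) (g : 'rV[R]_2 -> R) : Prop :=
  forall p, U p -> differentiable g p /\ gradient g p = F p.

Definition dw_column (R : realType) (w : 'rV[R]_2 -> 'rV[R]_2) (p : 'rV[R]_2) :
    'cV[R]_4 :=
  let u q := w q 0 0 in
  let v q := w q 0 1 in
  \col_k [:: 'D_(e1 R) u p; 'D_(e2 R) u p; 'D_(e1 R) v p; 'D_(e2 R) v p]`_k.

(* w is a (classical) solution on U of the system <A : dw> = 0. *)
Definition solution (R : realType) (U : set 'rV[R]_2)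
    (A : 'rV[R]_2 -> 'M[R]_(2, 4)) (w : 'rV[R]_2 -> 'rV[R]_2) : Prop :=
  forall p, U p -> differentiable w p /\ A p *m dw_column w p = 0.

Definition equivalent_systems (R : realType) (U : set 'rV[R]_2)
    (A1 A2 : 'rV[R]_2 -> 'M[R]_(2, 4)) : Prop :=
  exists M : 'rV[R]_2 -> 'M[R]_2, forall p, U p ->
    M p \in unitmx /\ A2 p = M p *m A1 p.

Definition mx24 (R : realType) (rows : seq (seq R)) : 'M[R]_(2, 4) :=
  \matrix_(i, j) (nth [::] rows i)`_j.

(* Main.v *)
(* For a phi-A-differentiable w, the partial derivatives are the A-products
   w_x = f' (-b14, -b24) and w_y = f' (b13, b23). Substituting these into the
   second system leaves polynomial identities in f', gamma, delta and the b's;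
   the pointwise invertible matrix M carries the conclusion back to A. *)
From HB Require Import structures.
Require Import Defs.
From mathcomp Require Import all_boot all_order all_algebra.
From mathcomp Require Import all_classical all_reals all_analysis.
From mathcomp Require Import ring.
Import Order.TTheory GRing.Theory Num.Theory.
Import numFieldNormedType.Exports.
Local Open Scope classical_set_scope.
Local Open Scope ring_scope.

(** Taking an entry is linear and continuous, hence its own differential, and the chain rule
    applies. This turns the partials of [u] and [v] in [dw_column] into entries of ['d w]. *)
Lemma derive_coord (R : realType) (V : normedModType R) (m n : nat)
    (w : V -> 'M[R]_(m.+1, n.+1)) (p v : V) (i : 'I_m.+1) (j : 'I_n.+1) :
  differentiable w p -> 'D_v (fun q => w q i j) p = 'd w p v i j.
Proof.
move=> dw; pose c (N : 'M[R]_(m.+1, n.+1)) : R := N i j.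
have c_lin : linear c by move=> a M N; rewrite /c !mxE.
pose cM := GRing.isLinear.Build _ _ _ _ _ c_lin.
pose cL : {linear 'M[R]_(m.+1, n.+1) -> R} := HB.pack c cM.
have dc : differentiable c (w p) by exact: differentiable_coord.
rewrite -[fun q => w q i j]/(c \o w) deriveE; last exact: differentiable_comp.
by rewrite diff_comp //= -[c]/(cL : _ -> _) diff_lin //; exact: coord_continuous.
Qed.

Lemma vec2E (R : realType) (a b : R) : vec2 a b = a *: e1 R + b *: e2 R.
Proof.
by apply/rowP => -[[|[|//]] ?]; rewrite !mxE /= ?mulr0 ?mulr1 ?addr0 ?add0r.
Qed.

(** Splitting along [e1], [e2] reduces this to the rules for sums and for scaling a fixed vector. *)
Lemma diff_vec2 (R : realType) (V : normedModType R) (f g : V -> R) (p v : V) :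
  differentiable f p -> differentiable g p ->
  'd (fun q => vec2 (f q) (g q)) p v = vec2 ('d f p v) ('d g p v).
Proof.
move=> df dg.
have df1 := differentiableZl (e1 R) df; have dg2 := differentiableZl (e2 R) dg.
have -> : (fun q => vec2 (f q) (g q)) =
    (fun q => f q *: e1 R) + (fun q => g q *: e2 R).
  by apply/funext => q; rewrite vec2E.
rewrite (diffD df1 dg2) /= vec2E.
by congr (_ + _); [rewrite (diffZl (e1 R) df)|rewrite (diffZl (e2 R) dg)].
Qed.

Lemma A22_mulE (R : realType) (gamma delta : R) (a : 'rV[R]_2) (c1 c2 : R) :
  A22_mul gamma delta a (vec2 c1 c2) =
  vec2 (gamma * (a 0 0 * c1) + a 0 0 * c2 + a 0 1 * c1)
       (delta * (a 0 0 * c1) + a 0 1 * c2).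
Proof.
rewrite /A22_mul !big_ord_recl !big_ord0 /A22_table /=.
(* The index left by unfolding the sums must become [1], so that [ring] sees the same coordinates on
   both sides. *)
have -> : lift ord0 ord0 = 1 :> 'I_2 by exact: val_inj.
by apply/rowP => -[[|[|//]] ?]; rewrite !mxE /=; ring.
Qed.

Lemma partials_potential (R : realType) (U : set 'rV[R]_2) (a b phi : 'rV[R]_2 -> R)
    (p : 'rV[R]_2) : potential U (fun q => vec2 (a q) (b q)) phi -> U p ->
  [/\ differentiable phi p, 'd phi p (e1 R) = a p & 'd phi p (e2 R) = b p].
Proof.
move=> pot /pot [dphi /rowP grad].
split=> //; rewrite -deriveE //.
- by have := grad 0; rewrite !mxE.
- by have := grad 1; rewrite !mxE.
Qed.

Theorem proposition2p3 (R : realType) (U : set 'rV[R]_2)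
    (A : 'rV[R]_2 -> 'M[R]_(2, 4))
    (gamma delta : R)
    (b13 b14 b23 b24 phi1 phi2 : 'rV[R]_2 -> R) :
  open U ->
  potential U (fun p => vec2 (- b14 p) (b13 p)) phi1 ->
  potential U (fun p => vec2 (- b24 p) (b23 p)) phi2 ->
  equivalent_systems U A (fun p => mx24
    [:: [:: gamma * b13 p + b23 p; gamma * b14 p + b24 p; b13 p; b14 p];
        [:: delta * b13 p;         delta * b14 p;         b23 p; b24 p]]) ->
  forall w : 'rV[R]_2 -> 'rV[R]_2,
    phiA_differentiable gamma delta U (fun p => vec2 (phi1 p) (phi2 p)) w ->
    solution U A w.
Proof.
move=> _ pot1 pot2 [M equivM] w [dw [f' df']] p Up.
have [Munit eqM] := equivM p Up.
split; first exact: dw.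
have [dphi1 phi1x phi1y] := partials_potential _ _ _ _ _ _ pot1 Up.
have [dphi2 phi2x phi2y] := partials_potential _ _ _ _ _ _ pot2 Up.
(* As [M p] is invertible, it suffices to solve the second system. *)
suff sysB : M p *m (A p *m dw_column w p) = 0.
  by rewrite -[LHS](mulKmx Munit) sysB mulmx0.
rewrite mulmxA -eqM.
have wx : 'd w p (e1 R) = A22_mul gamma delta (f' p) (vec2 (- b14 p) (- b24 p)).
  by rewrite df' // diff_vec2 // phi1x phi2x.
have wy : 'd w p (e2 R) = A22_mul gamma delta (f' p) (vec2 (b13 p) (b23 p)).
  by rewrite df' // diff_vec2 // phi1y phi2y.
apply/colP => i; rewrite !mxE !big_ord_recl big_ord0 !mxE /=.
rewrite !derive_coord ?wx ?wy ?A22_mulE; try exact: dw.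
(* The two rows are the coordinates of $\varphi_y w_x - \varphi_x w_y$ in the algebra; both products
   equal $f'\varphi_x\varphi_y$ since the algebra is commutative and associative. *)
by case: i => -[|[|//]] ?; rewrite !mxE /=; ring.
Qed.
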